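(* Let $R$ be a ring, let $\mathcal{X}$ be a non-empty class of right $R$-modules closed under isomorphisms, and let $M$ be a right $R$-module with a monomorphic $\mathcal{X}$-envelope $u:M\to X$ such that $\mathrm{End}(X)/J(\mathrm{End}(X))$ is a von Neumann regular right self-injective ring and idempotents lift modulo $J(\mathrm{End}(X))$. Let $M$ be $\mathcal{X}$-automorphism-invariant and assume that every direct summand of $M$ has an $\mathcal{X}$-envelope. Then $M$ is a clean module.
   Context: Rings are associative with identity, modules are unital right modules, $J(-)$ is the Jacobson radical. An $\mathcal{X}$-preenvelope of $M$ is a homomorphism $u:M\to X$ with $X\in\mathcal{X}$ such that every homomorphism $M\to X'$ with $X'\in\mathcal{X}$ factors through $u$. It is an $\mathcal{X}$-envelope if, moreover, every endomorphism $h$ of $X$ with $h\circ u=u$ is an automorphism; it is monomorphic if $u$ is a monomorphism. $M$ is $\mathcal{X}$-automorphism-invariant if there is an $\mathcal{X}$-envelope $u:M\to X$ such that for every automorphism $g$ of $X$ there is an endomorphism $f$ of $M$ with $u\circ f=g\circ u$. A ring is clean if each of its elements is the sum of an idempotent and a unit; a module $M$ is clean if $\mathrm{End}(M)$ is a clean ring. *)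

(* Defs.v *)
From HB Require Import structures.
From mathcomp Require Import all_boot all_algebra.
From mathcomp Require Import boolp classical_sets.

Set Implicit Arguments.
Unset Strict Implicit.
Unset Printing Implicit Defensive.

Import GRing.Theory.
Local Open Scope ring_scope.
Local Open Scope quotient_scope.

(* Rings are associative with 1, and 1 = 0 is allowed ([pzRingType]): the      *)
(* endomorphism ring of the zero module is the zero ring.                      *)

(* A right R-module is a left module over the converse ring R^c; the right     *)
(* action m . r is r *: m.                                                     *)
Notation rmodType R := (lmodType R^c).

Lemma lin_ext (A : pzRingType) (M N : lmodType A) (f g : {linear M -> N}) :
  f =1 g -> f = g.
Proof.
case: f g => [f [[fs] [fa]]] [g [[gs] [ga]]] /= /funext fg.
by subst g; rewrite (Prop_irrelevance fs gs) (Prop_irrelevance fa ga).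
Qed.

Definition endo {A : pzRingType} (M : lmodType A) : Type := {linear M -> M}.

Section EndoRing.
Context {A : pzRingType} {M : lmodType A}.
Implicit Types f g h : endo M.

HB.instance Definition _ := gen_eqMixin (endo M).
HB.instance Definition _ := gen_choiceMixin (endo M).

Definition endo_zero : endo M := (\0 : M -> M).
Definition endo_one : endo M := (idfun : M -> M).
Definition endo_opp f : endo M := (\- f : M -> M).
Definition endo_add f g : endo M := (f \+ g : M -> M).
Definition endo_mul f g : endo M := (f \o g : M -> M).

Fact endo_addA : associative endo_add.
Proof. by move=> f g h; apply: lin_ext => x /=; rewrite addrA. Qed.
Fact endo_addC : commutative endo_add.
Proof. by move=> f g; apply: lin_ext => x /=; rewrite addrC. Qed.
Fact endo_add0 : left_id endo_zero endo_add.
Proof. by move=> f; apply: lin_ext => x /=; rewrite add0r. Qed.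
Fact endo_addN : left_inverse endo_zero endo_opp endo_add.
Proof. by move=> f; apply: lin_ext => x /=; rewrite addNr. Qed.
Fact endo_mulA : associative endo_mul.
Proof. by move=> f g h; apply: lin_ext. Qed.
Fact endo_mul1l : left_id endo_one endo_mul.
Proof. by move=> f; apply: lin_ext. Qed.
Fact endo_mul1r : right_id endo_one endo_mul.
Proof. by move=> f; apply: lin_ext. Qed.
Fact endo_mulDl : left_distributive endo_mul endo_add.
Proof. by move=> f g h; apply: lin_ext. Qed.
Fact endo_mulDr : right_distributive endo_mul endo_add.
Proof. by move=> f g h; apply: lin_ext => x /=; rewrite raddfD. Qed.

HB.instance Definition _ := GRing.isPzRing.Build (endo M)
  endo_addA endo_addC endo_add0 endo_addN
  endo_mulA endo_mul1l endo_mul1r endo_mulDl endo_mulDr.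

End EndoRing.

Section JacobsonRadical.
Variable S : pzRingType.
Local Open Scope classical_set_scope.

Definition right_ideal (I : set S) : Prop :=
  [/\ I 0, forall x y, I x -> I y -> I (x + y) & forall x r, I x -> I (x * r)].

Definition maximal_right_ideal (I : set S) : Prop :=
  [/\ right_ideal I, I <> setT
    & forall K, right_ideal K -> I `<=` K -> K = I \/ K = setT].

Definition jacobson : set S :=
  [set x | forall I, maximal_right_ideal I -> I x].

Lemma right_idealN I x : right_ideal I -> I x -> I (- x).
Proof. by case=> _ _ IM Ix; rewrite -mulrN1; apply: IM. Qed.

Lemma right_idealT I : right_ideal I -> I 1 -> I = setT.
Proof.
case=> _ _ IM I1; apply/seteqP; split=> // x _.
by rewrite -[x]mul1r; apply: IM.
Qed.

Lemma jacobson_right_ideal : right_ideal jacobson.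
Proof.
split=> [I [[]]//|x y Jx Jy I mI|x r Jx I mI].
  by case: (mI) => -[_ ID _] _ _; apply: ID; [apply: Jx | apply: Jy].
by case: (mI) => -[_ _ IM] _ _; apply: IM; apply: Jx.
Qed.

Lemma jacobsonMl s x : jacobson x -> jacobson (s * x).
Proof.
move=> Jx I mI; case: (mI) => rI InT Imax; case: (rI) => I0 ID IM.
have [Is|nIs] := pselect (I s); first exact: IM.
apply: (Jx [set r | I (s * r)]); split.
- split=> [|a b Ia Ib|a r Ia] /=; first by rewrite mulr0.
  + by rewrite mulrDr; apply: ID.
  + by rewrite mulrA; apply: IM.
- by move=> /seteqP[_ /(_ 1 Logic.I)] /=; rewrite mulr1.
- move=> K rK IK; case: (rK) => K0 KD KM.
  have [[a [Ka nIa]]|nK] := pselect (exists a, K a /\ ~ I (s * a)); last first.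
    left; apply/seteqP; split=> // a Ka /=.
    by apply: contrapT => nIa; apply: nK; exists a.
  right; apply: right_idealT => //.
  pose L := [set y | exists t k, I k /\ y = s * a * t + k].
  have rL : right_ideal L.
    split=> [|_ _ [t [k [Ik ->]]] [t' [k' [Ik' ->]]]|_ r [t [k [Ik ->]]]].
    + by exists 0, 0; rewrite mulr0 addr0.
    + exists (t + t'), (k + k'); split; first exact: ID.
      by rewrite mulrDr addrACA.
    + exists (t * r), (k * r); split; first exact: IM.
      by rewrite mulrDl mulrA.
  have IL : I `<=` L by move=> k Ik; exists 0, k; rewrite mulr0 add0r.
  have La : L (s * a) by exists 1, 0; rewrite mulr1 addr0.
  have [LI|LT] := Imax L rL IL; first by case: nIa; rewrite -LI.
  have : L s by rewrite LT.
  case=> t [k [Ik sE]].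
  have Kat : K (1 - a * t).
    apply: IK => /=; rewrite mulrBr mulr1 mulrA [X in X - _]sE.
    by rewrite addrAC subrr add0r.
  by rewrite -[1](subrK (a * t)); apply: KD => //; apply: KM.
Qed.

End JacobsonRadical.

Section JacobsonQuotient.
Variable S : pzRingType.

Definition jacobson_pred : S -> bool := fun x => `[< jacobson x >].

Fact jacobson_zmod_closed : zmod_closed jacobson_pred.
Proof.
have rJ := jacobson_right_ideal S; case: (rJ) => J0 JD _.
split=> [|x y /asboolP Jx /asboolP Jy]; apply/asboolP => //.
exact: JD Jx (right_idealN rJ Jy).
Qed.

HB.instance Definition _ :=
  GRing.isZmodClosed.Build S jacobson_pred jacobson_zmod_closed.

Definition jac_zmod : zmodClosed S := GRing.ZmodClosed.clone S jacobson_pred _.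

Definition jac_quot : Type := Quotient.quot jac_zmod.

HB.instance Definition _ := GRing.Zmodule.on jac_quot.
HB.instance Definition _ := EqQuotient.on jac_quot.

Definition jac_one : jac_quot := \pi_jac_quot 1.
Definition jac_mul (x y : jac_quot) : jac_quot :=
  \pi_jac_quot (repr x * repr y).

Lemma jac_piE (x y : S) :
  \pi_jac_quot x = \pi_jac_quot y <-> jacobson (x - y).
Proof.
rewrite (rwP (asboolP (jacobson (x - y)))) -[`[< _ >]]/(x - y \in jac_zmod).
rewrite Quotient.idealrBE.
by split=> [->//|/eqP].
Qed.

Fact jac_pi_mul : {morph \pi_jac_quot : x y / x * y >-> jac_mul x y}.
Proof.
move=> x y; apply: (jac_piE _ _).2.
have [_ JD JM] := jacobson_right_ideal S.
have Jr (z : S) : jacobson (z - repr (\pi_jac_quot z)).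
  by apply: (jac_piE _ _).1; rewrite reprK.
rewrite -[x * y](subrK (x * repr (\pi_jac_quot y))) -addrA -mulrBr -mulrBl.
by apply: JD; [apply: jacobsonMl | apply: JM].
Qed.

Fact jac_pi_add : {morph \pi_jac_quot : x y / x + y >-> x + y}.
Proof. exact: Quotient.pi_add. Qed.

Fact jac_mulA : associative jac_mul.
Proof.
elim/quotW=> x; elim/quotW=> y; elim/quotW=> z.
by rewrite -(jac_pi_mul y z) -(jac_pi_mul x y) -(jac_pi_mul x (y * z))
  -(jac_pi_mul (x * y) z) mulrA.
Qed.
Fact jac_mul1l : left_id jac_one jac_mul.
Proof. by elim/quotW=> x; rewrite -(jac_pi_mul 1 x) mul1r. Qed.
Fact jac_mul1r : right_id jac_one jac_mul.
Proof. by elim/quotW=> x; rewrite -(jac_pi_mul x 1) mulr1. Qed.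
Fact jac_mulDl : left_distributive jac_mul +%R.
Proof.
elim/quotW=> x; elim/quotW=> y; elim/quotW=> z.
by rewrite -(jac_pi_add x y) -(jac_pi_mul (x + y) z) -(jac_pi_mul x z)
  -(jac_pi_mul y z) -(jac_pi_add (x * z) (y * z)) mulrDl.
Qed.
Fact jac_mulDr : right_distributive jac_mul +%R.
Proof.
elim/quotW=> x; elim/quotW=> y; elim/quotW=> z.
by rewrite -(jac_pi_add y z) -(jac_pi_mul x (y + z)) -(jac_pi_mul x y)
  -(jac_pi_mul x z) -(jac_pi_add (x * y) (x * z)) mulrDr.
Qed.

HB.instance Definition _ := GRing.Zmodule_isPzRing.Build jac_quot
  jac_mulA jac_mul1l jac_mul1r jac_mulDl jac_mulDr.

End JacobsonQuotient.

Section RingProperties.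
Variable S : pzRingType.
Implicit Types a b e f : S.

Definition idempotent_elt e : Prop := e * e = e.

Definition invertible_elt a : Prop := exists b, a * b = 1 /\ b * a = 1.

Definition clean_ring : Prop :=
  forall a, exists e v,
    [/\ idempotent_elt e, invertible_elt v & a = e + v].

Definition von_neumann_regular : Prop := forall a, exists b, a * b * a = a.

Definition idempotents_lift_mod_jacobson : Prop :=
  forall a, jacobson (a * a - a) ->
    exists e, idempotent_elt e /\ jacobson (e - a).

Definition injective_module (Q : rmodType S) : Prop :=
  forall (A B : rmodType S) (i : {linear A -> B}) (f : {linear A -> Q}),
    injective i -> exists g : {linear B -> Q}, g \o i =1 f.

(* S^c^o is S with scaling by a given by x |-> x * a: the right module S_S. *)
Definition right_self_injective : Prop := injective_module S^c^o.

End RingProperties.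

Section Submodules.
Variables (A : pzRingType) (M : lmodType A).

Definition submod_type (N : submodClosed M) : Type := {x : M | x \in N}.

Section SubmodInstances.
Variable N : submodClosed M.
HB.instance Definition _ := SubChoice.on (submod_type N).
HB.instance Definition _ := [SubChoice_isSubLmodule of submod_type N by <:].
End SubmodInstances.

Definition direct_summand (N : submodClosed M) : Prop :=
  exists K : submodClosed M,
    (forall x, exists y z, [/\ y \in N, z \in K & x = y + z]) /\
    (forall x, x \in N -> x \in K -> x = 0).

End Submodules.

Section Envelopes.
Variables (R : pzRingType) (X : rmodType R -> Prop).
Implicit Types M N E : rmodType R.

Definition isomorphic M N : Prop := exists f : {linear M -> N}, bijective f.

Definition closed_under_iso : Prop :=
  forall M N, isomorphic M N -> X M -> X N.

Definition preenvelope M E (u : {linear M -> E}) : Prop :=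
  X E /\ forall E' (v : {linear M -> E'}), X E' ->
    exists h : {linear E -> E'}, h \o u =1 v.

Definition envelope M E (u : {linear M -> E}) : Prop :=
  preenvelope u /\ forall h : {linear E -> E}, h \o u =1 u -> bijective h.

Definition has_envelope M : Prop :=
  exists E (u : {linear M -> E}), envelope u.

Definition automorphism_invariant M : Prop :=
  exists E (u : {linear M -> E}), envelope u /\
    forall g : {linear E -> E}, bijective g ->
      exists f : {linear M -> M}, u \o f =1 g \o u.

End Envelopes.

Definition clean_module (R : pzRingType) (M : rmodType R) : Prop :=
  clean_ring (endo M).

(* Main.v *)
(* Since u is an envelope, every f in End(M) extends along u to some g in       *)
(* End(E). A regular right self-injective ring is clean, and cleanness lifts    *)
(* modulo the Jacobson radical together with idempotents, so g = e + v with e   *)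
(* idempotent and v an automorphism. By invariance, v and its inverse restrict  *)
(* to M; hence so does e = g - v, and f is the sum of the two restrictions.     *)
(*                                                                              *)
(* To see that a regular right self-injective ring S is clean, fix a in S and   *)
(* take (Zorn) a maximal pair (W, e) with W an a-invariant right ideal and e    *)
(* an idempotent endomorphism of W such that a - e is bijective on W. By        *)
(* injectivity W = p S for an idempotent p. If q = 1 - p were nonzero, (W, e)   *)
(* would extend by a nonzero such pair for q a acting on q S: use e = 1 on a    *)
(* kernel, e = 0 if q a is bijective on q S, and otherwise a direct sum of the  *)
(* (q a)^n C, with C a complement of q a S in q S, on which q a is a shift.     *)

Require Import Defs.
From HB Require Import structures.
From mathcomp Require Import all_boot all_algebra.
From mathcomp Require Import boolp classical_sets.

Set Implicit Arguments.
Unset Strict Implicit.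
Unset Printing Implicit Defensive.

Import GRing.Theory.
Local Open Scope ring_scope.

(** The summand e of a clean decomposition need not be built on all of S = End(E)/J at once. Partial
    solutions are kept as graphs in S x S, so Zorn's lemma works by unions, and [baer_extension]
    turns a graph into a left multiplication. By [partial_clean_closure] the domain of a maximal
    solution is a summand pS. On a nonzero complement qS, [partial_clean_nontrivial] would give a
    further solution for qa; adding it makes a - e block triangular with bijective diagonal blocks,
    against maximality. This is [regular_self_injective_clean]. Then [clean_lift_mod_jacobson]
    passes to End(E), and [automorphism_invariant_envelope] lets the unit and its inverse restrict
    to M, where injectivity of u pulls the ring identities back. *)

(** * Zorn's lemma and unions of chains *)

Section Chains.
Local Open Scope classical_set_scope.

(** [Zorn_bigcup] also covers the empty chain, so [set0] is adjoined to [P]; if [set0] comes out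
    maximal, it must equal [A0]. *)
Lemma Zorn_bigcup_nonempty (T : Type) (P : set (set T)) (A0 : set T) :
  P A0 ->
  (forall F : set (set T), F !=set0 -> F `<=` P -> total_on F subset ->
     P (\bigcup_(A in F) A)) ->
  exists A, P A /\ forall B, P B -> A `<=` B -> B = A.
Proof.
move=> PA0 Pchain.
have [|A [PA maxA]] := @Zorn_bigcup T [set A | A = set0 \/ P A].
  move=> F FP Ftot.
  have [[A [FA PA]]|noP] := pselect (exists A, F A /\ P A); last first.
    left; apply/seteqP; split=> // x [A FA Ax].
    have [A0E|PA] := FP _ FA; first by rewrite A0E in Ax.
    by case: noP; exists A.
  right; suff -> : \bigcup_(B in F) B = \bigcup_(B in F `&` P) B.
    apply: Pchain; first by exists A.
    - by move=> B [].
    - by move=> B C [FB _] [FC _]; apply: Ftot.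
  apply/seteqP; split=> x [B FB Bx]; last by exists B => //; case: FB.
  have [B0|PB] := FP _ FB; last by exists B.
  by rewrite B0 in Bx.
have maxA' B : P B -> A `<=` B -> B = A.
  move=> PB AB; apply: contrapT => BA; apply: (maxA B); last by right.
  by split=> // BsA; apply: BA; apply/seteqP.
exists A; split=> //; case: PA => // A00.
suff <- : A0 = A by [].
by apply: maxA' => //; rewrite A00; apply: sub0set.
Qed.

Lemma chain_common (T : Type) (F : set (set T)) (x y : T) :
  total_on F subset -> (\bigcup_(A in F) A) x -> (\bigcup_(A in F) A) y ->
  exists A, [/\ F A, A x & A y].
Proof.
move=> Ftot [A FA Ax] [B FB By].
have [AB|BA] := Ftot _ _ FA FB.
- by exists B; split=> //; apply: AB.
- by exists A; split=> //; apply: BA.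
Qed.

Lemma right_ideal_chain (S : pzRingType) (F : set (set S)) :
  F !=set0 -> (forall A, F A -> right_ideal A) -> total_on F subset ->
  right_ideal (\bigcup_(A in F) A).
Proof.
move=> [A0 FA0] Fid Ftot; split.
- by exists A0 => //; case: (Fid _ FA0).
- move=> x y Ux Uy; have [A [FA Ax Ay]] := chain_common Ftot Ux Uy.
  by exists A => //; case: (Fid _ FA) => _ + _; apply.
- move=> x r [A FA Ax]; exists A => //.
  by case: (Fid _ FA) => _ _; apply.
Qed.

End Chains.

(** * Units modulo the Jacobson radical *)

Section RightIdeals.
Variable S : pzRingType.
Local Open Scope classical_set_scope.

Lemma maximal_right_ideal_ex (I : set S) :
  right_ideal I -> I <> setT -> exists K, maximal_right_ideal K /\ I `<=` K.
Proof.
move=> rI InT.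
have nI1 : ~ I 1 by move=> /(right_idealT rI).
have [||K [[rK IK nK1] maxK]] :=
  @Zorn_bigcup_nonempty S [set K | [/\ right_ideal K, I `<=` K & ~ K 1]] I.
- by split.
- move=> F [A0 FA0] FP Ftot; split.
  + apply: right_ideal_chain => //; first by exists A0.
    by move=> A /FP[].
  + by move=> x Ix; exists A0 => //; case: (FP _ FA0) => _ + _; apply.
  + by move=> [A /FP[_ _ nA1]].
exists K; split=> //; split=> // [KT|L rL KL]; first by apply: nK1; rewrite KT.
have [L1|nL1] := pselect (L 1); first by right; apply: right_idealT.
by left; apply: maxK => //; split=> //; apply: subset_trans IK KL.
Qed.

(** Were (1 - x)S proper, a maximal right ideal above it would contain x as well, hence 1. *)
Lemma jacobson_rinv (x : S) : jacobson x -> exists b, (1 - x) * b = 1.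
Proof.
move=> Jx; apply: contrapT => nob.
pose I := [set y | exists b, y = (1 - x) * b].
have rI : right_ideal I.
  split=> [|_ _ [b ->] [b' ->]|_ r [b ->]].
  - by exists 0; rewrite mulr0.
  - by exists (b + b'); rewrite mulrDr.
  - by exists (b * r); rewrite mulrA.
have InT : I <> setT.
  move=> IT; have : I 1 by rewrite IT.
  by case=> b bE; apply: nob; exists b.
have [K [mK IK]] := maximal_right_ideal_ex rI InT.
case: (mK) => rK KnT _; apply: KnT; apply: right_idealT => //.
rewrite -(subrK x 1); case: (rK) => _ KD _; apply: KD; last exact: Jx.
by apply: IK; exists 1; rewrite mulr1.
Qed.

Lemma jacobson_invertible (x : S) : jacobson x -> invertible_elt (1 - x).
Proof.
move=> Jx; have [b bE] := jacobson_rinv Jx.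
(* So b is again 1 minus a radical element and has a right inverse c; its left inverse 1 - x then
   equals c. *)
have bE' : b = 1 - (- (x * b)).
  by rewrite opprK -bE mulrBl mul1r subrK.
have Jxb : jacobson (- (x * b)).
  have rJ := jacobson_right_ideal S.
  by apply: (right_idealN rJ); case: rJ => _ _; apply.
have [c] := jacobson_rinv Jxb; rewrite -bE' => cE.
exists b; split=> //.
suff -> : 1 - x = c by [].
by rewrite -[c]mul1r -[X in X * c]bE -mulrA cE mulr1.
Qed.

(** Both vw and wv lie in 1 + J, so they are units, and v has an inverse on each side. *)
Lemma jac_invertible (v : S) :
  invertible_elt (\pi_(jac_quot S)%qT v) -> invertible_elt v.
Proof.
pose pi := \pi_(jac_quot S)%qT.
have piM x y : pi (x * y) = pi x * pi y := jac_pi_mul x y.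
move=> [w []]; elim/quotW: w => w; rewrite -/(pi v) -/(pi w) -!piM.
move=> /jac_piE Jvw /jac_piE Jwv.
have unit1 (y : S) : jacobson (y - 1) -> invertible_elt y.
  move=> Jy; have -> : y = 1 - (- (y - 1)) by rewrite opprK addrC subrK.
  by apply: jacobson_invertible; apply: (right_idealN (jacobson_right_ideal S)).
have [b [vwb _]] := unit1 _ Jvw; have [b' [_ b'wv]] := unit1 _ Jwv.
exists (w * b); split; first by rewrite mulrA.
suff -> : w * b = b' * w by rewrite -mulrA.
by rewrite -[LHS]mul1r -[X in X * _]b'wv -!mulrA (mulrA v) vwb mulr1.
Qed.

End RightIdeals.

(** * Homomorphisms between right ideals, as graphs *)

Section Graphs.
Variable S : pzRingType.
Local Open Scope classical_set_scope.

Definition submod2 (G : set (S * S)) : Prop :=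
  [/\ G (0, 0),
      forall x y x' y', G (x, y) -> G (x', y') -> G (x + x', y + y')
    & forall x y r, G (x, y) -> G (x * r, y * r)].

Definition functional_graph (G : set (S * S)) : Prop :=
  forall y, G (0, y) -> y = 0.

Lemma functional_graph_eq G x y y' :
  submod2 G -> functional_graph G -> G (x, y) -> G (x, y') -> y = y'.
Proof.
move=> [_ GD GM] Gf Gy Gy'; apply/eqP; rewrite -subr_eq0; apply/eqP/Gf.
by rewrite -(subrr x) -(mulrN1 x) -(mulrN1 y'); apply: GD => //; apply: GM.
Qed.

(* The graph of a homomorphism from a right ideal to S is itself a module,     *)
(* embedded in S by the first projection; the second projection extends to S.  *)
Lemma baer_extension G : right_self_injective S ->
  submod2 G -> functional_graph G ->
  exists e, forall x y, G (x, y) -> y = e * x.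
Proof.
move=> injS sG Gf; case: (sG) => G0 GD GM.
pose V : lmodType S^c := (S^c^o * S^c^o)%type.
pose P : {pred V} := fun z => `[< G z >].
have PS : GRing.submod_closed P.
  split=> [|r [x y] [x' y'] /asboolP Gx /asboolP Gx']; apply/asboolP => //.
  by apply: GD => //; apply: GM.
pose N : submodClosed V := HB.pack_for (submodClosed V) P
  (GRing.isSubmodClosed.Build S^c V P PS).
pose i : submod_type N -> S^c^o := fun z => (val z).1.
pose f : submod_type N -> S^c^o := fun z => (val z).2.
have li : linear i by move=> r x y; rewrite /i !linearP.
have lf : linear f by move=> r x y; rewrite /f !linearP.
pose iL : {linear submod_type N -> S^c^o} := HB.pack i (GRing.isLinear.Build _ _ _ _ i li).
pose fL : {linear submod_type N -> S^c^o} := HB.pack f (GRing.isLinear.Build _ _ _ _ f lf).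
have ii : injective iL.
  move=> [[x y] /= Gx] [[x' y'] /= Gx']; rewrite /iL /= /i /= => xx'.
  apply: val_inj => /=; rewrite xx'; congr pair.
  have /asboolP Gxy := Gx; have /asboolP Gxy' := Gx'.
  by rewrite xx' in Gxy; apply: functional_graph_eq Gxy Gxy'.
have [g gE] := injS _ _ iL fL ii.
(* An endomorphism of S_S is left multiplication by its value at 1. *)
exists (g 1) => x y Gxy.
have Nxy : ((x, y) : V) \in N by apply/asboolP.
have := gE (exist (fun z : V => z \in N) _ Nxy); rewrite /= /i /f /= => <-.
rewrite -[in LHS](mul1r x).
exact: (linearZ_LR g (x : S^c) (1 : S^c^o)).
Qed.

(** pS is an injective hull of W inside S. The last clause is the form of density used later: left
    multiplications that agree on W agree on pS. *)
Lemma right_ideal_closure (W : set S) :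
  right_self_injective S -> von_neumann_regular S -> right_ideal W ->
  exists p, [/\ p * p = p, forall w, W w -> p * w = w
    & forall z, (forall w, W w -> z * w = 0) -> z * p = 0].
Proof.
move=> injS regS rW; case: (rW) => W0 WD WM.
have [||C [[rC CW] maxC]] := @Zorn_bigcup_nonempty S
  [set C | right_ideal C /\ forall x, C x -> W x -> x = 0] [set 0].
- split=> [|x -> //]; split=> [//|_ _ -> ->|_ r ->]; first by rewrite /= addr0.
  by rewrite /= mul0r.
- move=> F F0 FP Ftot; split; first by apply: right_ideal_chain => // A /FP[].
  by move=> x [A /FP[_ AW] Ax]; apply: AW.
case: (rC) => C0 CD CM.
(* With zbz = z, the right ideal C + bzS still meets W in 0, because z kills both W and C.
   Maximality puts bz in C, so z = z(bz) = 0. *)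
have ess z : (forall w, W w -> z * w = 0) -> (forall c, C c -> z * c = 0) ->
    z = 0.
  move=> zW zC; have [b zbz] := regS z.
  pose D := [set x | exists c r, C c /\ x = c + b * z * r].
  have rD : right_ideal D.
    split=> [|_ _ [c [r [Cc ->]]] [c' [r' [Cc' ->]]]|_ s [c [r [Cc ->]]]].
    - by exists 0, 0; rewrite mulr0 addr0.
    - exists (c + c'), (r + r'); split; first exact: CD.
      by rewrite mulrDr addrACA.
    - exists (c * s), (r * s); split; first exact: CM.
      by rewrite mulrDl -!mulrA.
  have DW x : D x -> W x -> x = 0.
    move=> [c [r [Cc ->]]] Wx.
    have zr : z * r = 0.
      have := zW _ Wx.
      by rewrite mulrDr zC // add0r -!mulrA mulrA -[z * b * _]mulrA mulrA
                 mulrA zbz.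
    move: Wx; rewrite -mulrA zr mulr0 addr0; exact: CW.
  have DC : D = C.
    apply: maxC => [|c Cc]; first by split.
    by exists c, 0; rewrite mulr0 addr0.
  have Cbz : C (b * z).
    by rewrite -DC; exists 0, 1; rewrite add0r mulr1.
  by rewrite -zbz -mulrA zC.
(* The projection of W + C onto W along C; p extends it. *)
pose G := [set z : S * S | W z.2 /\ C (z.1 - z.2)].
have [||p pE] := @baer_extension G injS.
- split=> [|x y x' y' [/= Wy Cx] [/= Wy' Cx']|x y r [/= Wy Cx]].
  + by split=> //=; rewrite subrr.
  + split=> /=; first exact: WD.
    by rewrite opprD addrACA; apply: CD.
  + split=> /=; first exact: WM.
    by rewrite -mulrBl; apply: CM.
- move=> y [/= Wy]; rewrite sub0r => Cy; apply: CW => //.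
  by rewrite -[y]opprK; apply: right_idealN.
have pW w : W w -> p * w = w.
  by move=> Ww; rewrite -(pE w w) //; split=> //=; rewrite subrr.
have pC c : C c -> p * c = 0.
  by move=> Cc; rewrite -(pE c 0) //; split=> //=; rewrite subr0.
exists p; split=> // [|z zW].
- apply/eqP; rewrite -subr_eq0; apply/eqP/ess => x xI.
  + by rewrite mulrBl -mulrA !pW // subrr.
  + by rewrite mulrBl -mulrA !pC // subrr.
- apply: ess => x xI; first by rewrite -mulrA pW // zW.
  by rewrite -mulrA pC // mulr0.
Qed.

(* [G] is the graph of an idempotent endomorphism [e] of an [a]-invariant      *)
(* right ideal on which [a - e] is bijective.                                  *)
Record partial_clean (a : S) (G : set (S * S)) : Prop := PartialClean {
  pc_submod : submod2 G;
  pc_fun : functional_graph G;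
  pc_idem : forall x y, G (x, y) -> G (y, y);
  pc_stable : forall x y, G (x, y) -> exists z, G (a * x, z);
  pc_inj : forall x, G (x, a * x) -> x = 0;
  pc_surj : forall x y, G (x, y) ->
    exists x' y', G (x', y') /\ a * x' - y' = x }.

Lemma partial_clean_chain a (F : set (set (S * S))) :
  F !=set0 -> (forall G, F G -> partial_clean a G) -> total_on F subset ->
  partial_clean a (\bigcup_(G in F) G).
Proof.
move=> [G0 FG0] Fpc Ftot; split.
- split.
  + by exists G0 => //; case: (pc_submod (Fpc _ FG0)).
  + move=> x y x' y' Ux Ux'; have [G [FG Gx Gx']] := chain_common Ftot Ux Ux'.
    by exists G => //; case: (pc_submod (Fpc _ FG)) => _ + _; apply.
  + move=> x y r [G FG Gx]; exists G => //.
    by case: (pc_submod (Fpc _ FG)) => _ _; apply.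
- by move=> y [G FG]; apply: pc_fun (Fpc _ FG) _.
- by move=> x y [G FG Gx]; exists G => //; apply: pc_idem (Fpc _ FG) _ _ Gx.
- move=> x y [G FG Gx]; have [z Gz] := pc_stable (Fpc _ FG) Gx.
  by exists z, G.
- by move=> x [G FG]; apply: pc_inj (Fpc _ FG) _.
- move=> x y [G FG Gx].
  have [x' [y' [Gx' E]]] := pc_surj (Fpc _ FG) Gx.
  by exists x', y'; split=> //; exists G.
Qed.

Lemma partial_clean_total a G : right_self_injective S -> partial_clean a G ->
  (forall x, exists y, G (x, y)) ->
  exists e v, [/\ idempotent_elt e, invertible_elt v & a = e + v].
Proof.
move=> injS pcG Gtot; have [e eE] := baer_extension injS (pc_submod pcG) (pc_fun pcG).
have Ge x : G (x, e * x) by have [y Gy] := Gtot x; rewrite -(eE _ _ Gy).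
exists e, (a - e); split.
- by have := eE _ _ (pc_idem pcG (Ge 1)); rewrite mulr1.
- have [x [y [Gx]]] := pc_surj pcG (Ge 1).
  rewrite (eE _ _ Gx) -mulrBl => vx; exists x; split=> //.
  (* The right inverse x of a - e is also a left inverse: a - e kills x(a - e) - 1 and is
     injective. *)
  apply/eqP; rewrite -subr_eq0; apply/eqP/(pc_inj pcG).
  suff -> : a * (x * (a - e) - 1) = e * (x * (a - e) - 1) by [].
  by apply/eqP; rewrite -subr_eq0 -mulrBl [_ * (_ - 1)]mulrBr mulr1 mulrA vx mul1r subrr.
- by rewrite addrC subrK.
Qed.

End Graphs.

(** * Nonzero partial solutions on a summand qS *)

Section Shift.
Variable S : pzRingType.
Local Open Scope classical_set_scope.

(* On the direct sum of the [f^n c S], block the summands in pairs and put     *)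
(*   e (f^(2k) x) = 0,  e (f^(2k+1) x) = f^(2k) x + f^(2k+1) x + f^(2k+2) x.   *)
(* Then [f - e] preserves each pair, acting as the invertible [0, -1; 1, -1].  *)
Inductive shift_idempotent (f c : S) : S * S -> Prop :=
| ShiftIdem0 : shift_idempotent f c (0, 0)
| ShiftIdemS x y u v : shift_idempotent f c (u, v) ->
    shift_idempotent f c (c * x + f * (c * y + f * u),
                          c * y + f * (c * y + f * (c * y + v))).

Section ShiftIdempotent.
Variables f c q : S.
Hypotheses (qf : q * f = f) (qc : q * c = c).
(** That is, f is injective on qS and cS meets f(qS) only in 0. This makes the sum of the f^n c S
    direct: an equation can be peeled slot by slot. *)
Hypothesis dec : forall x w, q * w = w -> c * x + f * w = 0 ->
  c * x = 0 /\ w = 0.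
Let G := shift_idempotent f c.

Let qM x w : q * (c * x + f * w) = c * x + f * w.
Proof. by rewrite mulrDr !mulrA qf qc. Qed.

Lemma shift_idempotent_dom u v : G (u, v) -> q * u = u /\ q * v = v.
Proof.
move E : (u, v) => z Gz.
elim: Gz u v E => {z} [|x y u v Guv IH] u' v' [-> ->]; first by rewrite mulr0.
by rewrite !qM.
Qed.

Lemma shift_idempotent_submod : submod2 G.
Proof.
split; first exact: ShiftIdem0.
- move=> u v u' v'; move E : (u, v) => z Gz.
  elim: Gz u v u' v' E => {z} [|x y u v Guv IH] u1 v1 u2 v2 [-> ->].
    by rewrite !add0r.
  move E : (u2, v2) => z Gz.
  case: Gz E => {z} [|x' y' u' v' Guv'] [-> ->].
    by rewrite !addr0; apply: ShiftIdemS.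
  have -> : c * x + f * (c * y + f * u) + (c * x' + f * (c * y' + f * u')) =
      c * (x + x') + f * (c * (y + y') + f * (u + u')).
    rewrite addrACA -mulrDr -mulrDr; congr (_ + _ * _).
    by rewrite addrACA -mulrDr -mulrDr.
  have -> : c * y + f * (c * y + f * (c * y + v)) +
      (c * y' + f * (c * y' + f * (c * y' + v'))) =
      c * (y + y') + f * (c * (y + y') + f * (c * (y + y') + (v + v'))).
    rewrite addrACA -mulrDr -mulrDr; congr (_ + _ * _).
    rewrite addrACA -mulrDr -mulrDr; congr (_ + _ * _).
    by rewrite addrACA -mulrDr.
  by apply: ShiftIdemS; apply: IH.
- move=> u v r; move E : (u, v) => z Gz.
  elim: Gz u v E => {z} [|x y u v Guv IH] u1 v1 [-> ->].
    by rewrite mul0r; apply: ShiftIdem0.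
  rewrite !(mulrDl, =^~ mulrA).
  by apply: ShiftIdemS; apply: IH.
Qed.

Lemma shift_idempotent_fun : functional_graph G.
Proof.
suff H u v : G (u, v) -> u = 0 -> v = 0 by move=> v /H; apply.
move E : (u, v) => z Gz.
elim: Gz u v E => {z} [|x y u v Guv IH] u1 v1 [-> ->] //.
have [qu _] := shift_idempotent_dom Guv.
move=> /(dec (qM _ _))[_] /(dec qu)[-> u0].
by rewrite (IH _ _ erefl u0) !(addr0, mulr0).
Qed.

Let G0 x : G (c * x, 0).
Proof.
have := ShiftIdemS x 0 (ShiftIdem0 f c).
by rewrite !(mulr0, addr0).
Qed.

Lemma shift_idempotent_idem u v : G (u, v) -> G (v, v).
Proof.
move E : (u, v) => z Gz.
elim: Gz u v E => {z} [|x y u v Guv IH] u1 v1 [_ ->]; first exact: ShiftIdem0.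
(* The term f^2 c y of e(f c y) falls in the even slot of the next pair, where e vanishes; [G0 y]
   accounts for it. *)
apply: ShiftIdemS.
have [_ GD _] := shift_idempotent_submod.
have := GD _ _ _ _ (G0 y) (IH _ _ erefl); rewrite add0r; exact.
Qed.

Lemma shift_idempotent_stable u v : G (u, v) -> exists w, G (f * u, w).
Proof.
move E : (u, v) => z Gz.
elim: Gz u v E => {z} [|x y u v Guv IH] u1 v1 [-> _].
  by rewrite mulr0; exists 0; apply: ShiftIdem0.
have [w Gw] := IH _ _ erefl.
have [_ GD _] := shift_idempotent_submod.
(* Multiplication by f moves every entry one slot up: x becomes odd, and y becomes even in the next
   pair. *)
have := ShiftIdemS 0 x (GD _ _ _ _ (G0 y) Gw).
by rewrite mulr0 add0r => ?; eexists; eassumption.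
Qed.

Lemma shift_idempotent_inj u : G (u, f * u) -> u = 0.
Proof.
suff H u' v : G (u', v) -> f * u' = v -> u' = 0 by move=> /H; apply.
move E : (u', v) => z Gz.
elim: Gz u' v E => {z} [|x y w v' Guv IH] u1 v1 [-> ->] //.
have [qw qv'] := shift_idempotent_dom Guv.
move=> E.
(* The difference of the two sides of [E], sorted by slots. *)
have : c * y + f * (c * (y - x) + f * (v' - f * w)) = 0.
  have -> : c * (y - x) + f * (v' - f * w) =
      c * y + f * (c * y + v') - (c * x + f * (c * y + f * w)).
    rewrite opprD addrACA -mulrBr -mulrBr; congr (_ + _ * _).
    by rewrite opprD addrACA subrr add0r.
  by rewrite mulrBr addrA -E subrr.
have qr : q * (v' - f * w) = v' - f * w by rewrite mulrBr mulrA qf qv'.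
move=> /(dec (qM _ _))[y0] /(dec qr)[].
rewrite mulrBr y0 sub0r => /eqP; rewrite oppr_eq0 => /eqP -> /eqP.
rewrite subr_eq0 => /eqP v'E.
by rewrite (IH _ _ erefl (esym v'E)) !(addr0, mulr0).
Qed.

Lemma shift_idempotent_surj u v : G (u, v) ->
  exists u' v', G (u', v') /\ f * u' - v' = u.
Proof.
move E : (u, v) => z Gz.
elim: Gz u v E => {z} [|x y u v Guv IH] u1 v1 [-> _].
  by exists 0, 0; rewrite mulr0 subrr; split=> //; apply: ShiftIdem0.
have [u' [v' [Guv' <-]]] := IH _ _ erefl.
(* The entries (y - x, -x) are the inverse matrix [-1, 1; -1, 0] applied to (x, y). *)
exists (c * (y - x) + f * (c * - x + f * u')).
exists (c * - x + f * (c * - x + f * (c * - x + v'))).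
split; first exact: ShiftIdemS.
rewrite opprD addrCA mulrN opprK; congr (_ + _).
rewrite -mulrBr opprD addrACA mulrBr opprK subrK -mulrBr.
by rewrite opprD addrACA subrr add0r.
Qed.

Lemma shift_idempotent_clean : partial_clean f G.
Proof.
split.
- exact: shift_idempotent_submod.
- exact: shift_idempotent_fun.
- exact: shift_idempotent_idem.
- exact: shift_idempotent_stable.
- exact: shift_idempotent_inj.
- exact: shift_idempotent_surj.
Qed.

End ShiftIdempotent.

Lemma partial_clean_nontrivial (f q : S) : von_neumann_regular S ->
  q * q = q -> q <> 0 -> q * f = f ->
  exists G, [/\ partial_clean f G, forall x y, G (x, y) -> q * x = x
    & exists x y, G (x, y) /\ x <> 0].
Proof.
move=> regS qq q0 qf.
have [[z [qz fz z0]]|noker] :=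
  pselect (exists z, [/\ q * z = z, f * z = 0 & z <> 0]).
  (* On zS, f is zero and e is the identity, so f - e = -1. *)
  exists [set w | w.1 = w.2 /\ exists r, w.1 = z * r]; split.
  - split=> /=.
    + split=> /= [|_ _ _ _ [<- [r ->]] [<- [r' ->]]|_ _ s [<- [r ->]]].
      * by split=> //; exists 0; rewrite mulr0.
      * by split=> //; exists (r + r'); rewrite mulrDr.
      * by split=> //; exists (r * s); rewrite mulrA.
    + by move=> y [/= <-].
    + by move=> x y [/= -> xr]; split.
    + move=> _ _ [/= _ [r ->]]; exists 0; rewrite mulrA fz mul0r.
      by split=> //=; exists 0; rewrite mulr0.
    + by move=> x [/= E [r rE]]; rewrite E rE mulrA fz mul0r.
    + move=> _ _ [/= _ [r ->]]; exists (- (z * r)), (- (z * r)).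
      split; last by rewrite mulrN mulrA fz mul0r oppr0 sub0r opprK.
      by split=> //=; exists (- r); rewrite mulrN.
  - by move=> _ _ [/= _ [r ->]]; rewrite mulrA qz.
  - by exists z, z; split=> //; split=> //=; exists 1; rewrite mulr1.
have finj z : q * z = z -> f * z = 0 -> z = 0.
  by move=> qz fz; apply: contrapT => z0; apply: noker; exists z.
have [b fbf] := regS (f * q).
(* h is an idempotent with image f(qS), and c = (1 - h)q generates a complement of that image in
   qS. *)
pose h := f * q * b.
have hf w : q * w = w -> h * (f * w) = f * w.
  by move=> qw; rewrite -{1}qw [f * (q * w)]mulrA mulrA fbf -mulrA qw.
have qh : q * h = h by rewrite /h !mulrA qf.
have hh : h * h = h by rewrite {2 3}/h mulrA fbf.
pose c := q - h * q.
have qc : q * c = c by rewrite mulrBr qq mulrA qh.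
have hc : h * c = 0 by rewrite mulrBr mulrA hh subrr.
have [c0|c_neq0] := pselect (c = 0).
  have qE : q = h * q by apply/eqP; rewrite -subr_eq0; apply/eqP.
  exists [set w | q * w.1 = w.1 /\ w.2 = 0]; split.
  - split=> /=.
    + split=> /= [|x _ x' _ [qx ->] [qx' ->]|x _ r [qx ->]].
      * by rewrite mulr0.
      * by rewrite mulrDr qx qx' addr0.
      * by rewrite mulrA qx mul0r.
    + by move=> y [].
    + by move=> x _ [/= _ ->]; rewrite mulr0.
    + by move=> x _ [/= _ _]; exists 0; rewrite mulrA qf.
    + by move=> x [/= qx]; apply: finj.
    + move=> x _ [/= qx _]; exists (q * b * q * x), 0.
      split; first by rewrite !mulrA qq.
      by rewrite subr0 !mulrA -[f * q * b]/h -qE.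
  - by move=> x y [].
  - by exists q, 0.
exists (shift_idempotent f c); split.
- apply: (@shift_idempotent_clean f c q) => // x w qw E.
  have cx0 : c * x = 0.
    have := congr1 ( *%R h) E.
    by rewrite mulr0 mulrDr mulrA hc mul0r add0r hf // => fw0; rewrite fw0 addr0 in E.
  by split=> //; apply: finj => //; rewrite cx0 add0r in E.
- by move=> u v /(shift_idempotent_dom qf qc)[].
- exists (c * 1), 0; split; last by rewrite mulr1.
  have := ShiftIdemS 1 0 (ShiftIdem0 f c).
  by rewrite !(mulr0, addr0).
Qed.
End Shift.

(** * Regular right self-injective rings are clean *)

Section RegularSelfInjective.
Variable S : pzRingType.
Local Open Scope classical_set_scope.
Hypotheses (regS : von_neumann_regular S) (injS : right_self_injective S).

(** Extend e and the inverse v of a - e from W to left multiplications. By density, every identity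
    between them that holds on W persists on pS. *)
Lemma partial_clean_closure (a : S) G : partial_clean a G ->
  exists p e, [/\ p * p = p, p * a * p = a * p,
    partial_clean a [set z | p * z.1 = z.1 /\ z.2 = e * z.1]
    & G `<=` [set z | p * z.1 = z.1 /\ z.2 = e * z.1]].
Proof.
move=> pcG; have sG := pc_submod pcG; case: (sG) => G0 GD GM.
have [e eE] := baer_extension injS sG (pc_fun pcG).
pose W := [set x | exists y, G (x, y)].
have We x : W x -> G (x, e * x) by move=> [y Gx]; rewrite -(eE _ _ Gx).
have rW : right_ideal W.
  split=> [|x x' [y Gx] [y' Gx']|x r [y Gx]]; first by exists 0.
  - by exists (y + y'); apply: GD.
  - by exists (y * r); apply: GM.
have [p [pp pW Wp]] := right_ideal_closure injS regS rW.
have eqp z z' : (forall w, W w -> z * w = z' * w) -> z * p = z' * p.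
  move=> zz'; apply/eqP; rewrite -subr_eq0 -mulrBl; apply/eqP/Wp => w Ww.
  by rewrite mulrBl zz' // subrr.
have stab z : (forall w, W w -> W (z * w)) -> p * z * p = z * p.
  by move=> zW; apply: eqp => w Ww; rewrite -mulrA pW //; apply: zW.
have We_e w : W w -> W (e * w).
  by move=> /We Gw; exists (e * w); apply: pc_idem pcG _ _ Gw.
have pe : p * e * p = e * p by apply: stab.
have pa : p * a * p = a * p.
  by apply: stab => w [y Gw]; apply: pc_stable pcG _ _ Gw.
have ee : e * e * p = e * p.
  apply: eqp => w /We Gw; rewrite -mulrA; apply/esym.
  exact: eE _ _ (pc_idem pcG Gw).
(* The graph of the inverse of a - e on W. *)
pose H := [set z | exists x, G (x, e * x) /\ z = (a * x - e * x, x)].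
have [||v vE] := @baer_extension S H injS.
- split=> [|x y x' y' [t [Gt [-> ->]]] [t' [Gt' [-> ->]]]|x y r [t [Gt [-> ->]]]].
  + by exists 0; rewrite !mulr0 subrr; split.
  + exists (t + t'); split; first by rewrite mulrDr; apply: GD.
    by rewrite !mulrDr opprD addrACA.
  + exists (t * r); split; first by rewrite mulrA; apply: GM.
    by rewrite mulrBl !mulrA.
- move=> y [x [Gx [/esym/eqP]]]; rewrite subr_eq0 => /eqP ae ->.
  by apply: (pc_inj pcG); rewrite ae.
have vae w : W w -> v * (a * w - e * w) = w.
  by move=> /We Gw; apply/esym/vE; exists w.
have vW w : W w -> W (v * w) /\ a * (v * w) - e * (v * w) = w.
  move=> [y Gw]; have [x' [y' [Gx' wE]]] := pc_surj pcG Gw.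
  have y'E := eE _ _ Gx'; rewrite y'E in wE.
  by rewrite -wE vae; [split=> //; exists y' | exists y'].
have pv : p * v * p = v * p by apply: stab => w /vW[].
have vp : v * (a - e) * p = p.
  rewrite -[RHS]mul1r; apply: eqp => w /vae vw.
  by rewrite -mulrA mulrBl vw mul1r.
have pv' : (a - e) * v * p = p.
  rewrite -[RHS]mul1r; apply: eqp => w /vW[_ vw].
  by rewrite -mulrA mulrBl vw mul1r.
exists p, e; split=> //; last first.
  move=> [x y] Gx /=; split; last exact: eE Gx.
  by apply: pW; exists y.
split=> /=.
- split=> /= [|x y x' y' [px ->] [px' ->]|x y r [px ->]].
  + by rewrite !mulr0.
  + by rewrite !mulrDr px px'.
  + by rewrite !mulrA px.
- by move=> y [/= _ ->]; rewrite mulr0.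
- move=> x y [/= px ->]; rewrite -px !mulrA pe; split=> //.
  by rewrite ee.
- by move=> x y [/= px _]; exists (e * (a * x)); rewrite -px !mulrA pa.
- move=> x [/= px ax].
  by rewrite -px -vp -!mulrA px mulrBl ax subrr mulr0.
- move=> x y [/= px _]; exists (v * x), (e * (v * x)).
  split; first by rewrite -px !mulrA pv.
  by rewrite -mulrBl -px !mulrA pv'.
Qed.

Lemma regular_self_injective_clean : clean_ring S.
Proof.
move=> a.
have [||G [pcG maxG]] :=
  @Zorn_bigcup_nonempty (S * S)%type (partial_clean a) [set (0, 0)].
- split=> /=.
  + split=> [//|x y x' y' [-> ->] [-> ->]|x y r [-> ->]] /=.
      by rewrite addr0.
    by rewrite mul0r.
  + by move=> y [].
  + by move=> x y [_ ->].
  + by move=> x y [-> _]; exists 0; rewrite mulr0.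
  + by move=> x [].
  + by move=> x y [-> _]; exists 0, 0; rewrite mulr0 subrr.
- by move=> F F0 FP; apply: partial_clean_chain.
have [p [e [pp pa pcG' /(maxG _ pcG') GE]]] := partial_clean_closure pcG.
apply: (partial_clean_total injS pcG) => x; rewrite -GE.
suff -> : p = 1 by exists (e * x); rewrite /= mul1r.
pose q := 1 - p.
apply: contrapT => p1.
have q0 : q <> 0 by move=> /eqP; rewrite subr_eq0 => /eqP/esym.
have qp : q * p = 0 by rewrite mulrBl mul1r pp subrr.
have pq : p * q = 0 by rewrite mulrBr mulr1 pp subrr.
have qq : q * q = q by rewrite [LHS]mulrBr mulr1 qp subr0.
have [H [pcH qH [h [h' [Hh h0]]]]] : exists H,
    [/\ partial_clean (q * a) H, forall x y, H (x, y) -> q * x = x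
      & exists x y, H (x, y) /\ x <> 0].
  by apply: partial_clean_nontrivial => //; rewrite mulrA qq.
have [H0 HD HM] := pc_submod pcH.
have qH' y z : H (y, z) -> q * z = z by move=> /(pc_idem pcH)/qH.
have ppx y : p * y = y -> q * y = 0 by move=> <-; rewrite mulrA qp mul0r.
have pqx y : q * y = y -> p * y = 0 by move=> <-; rewrite mulrA pq mul0r.
(* The idempotent is block diagonal on the sum of pS and the domain of [H]. Since a preserves pS but
   perhaps not qS, a - e is only block triangular, with corner pa. *)
pose K := [set w | exists x y z, [/\ p * x = x, H (y, z)
                    & w = (x + y, e * x + z)]].
have Gpe y : p * y = y -> p * (e * y) = e * y.
  move=> py; have Gy : G (y, e * y) by rewrite -GE.
  by have := pc_idem pcG Gy; rewrite -GE => -[].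
have Gee y : p * y = y -> e * (e * y) = e * y.
  move=> py; have Gy : G (y, e * y) by rewrite -GE.
  by have := pc_idem pcG Gy; rewrite -GE => -[_ /= <-].
have pax y : p * y = y -> p * (a * y) = a * y.
  by move=> <-; rewrite !mulrA pa.
have sum0 y z : p * y = y -> q * z = z -> y + z = 0 -> y = 0 /\ z = 0.
  move=> py qz yz; have := congr1 ( *%R p) yz.
  rewrite mulrDr py pqx // addr0 mulr0 => y0.
  by split=> //; move: yz; rewrite y0 add0r.
have adec y : p * (a * y) + q * a * y = a * y.
  by rewrite mulrA -mulrDl -mulrDl addrC subrK mul1r.
have pcK : partial_clean a K.
  split.
  - split.
    + by exists 0, 0, 0; rewrite !mulr0 addr0; split.
    + move=> _ _ _ _ [x1 [y1 [z1 [px1 H1 [-> ->]]]]]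
                     [x2 [y2 [z2 [px2 H2 [-> ->]]]]].
      exists (x1 + x2), (y1 + y2), (z1 + z2); split.
      * by rewrite mulrDr px1 px2.
      * exact: HD.
      * by rewrite mulrDr addrACA [in X in (_, X)]addrACA.
    + move=> _ _ r [x1 [y1 [z1 [px1 H1 [-> ->]]]]].
      exists (x1 * r), (y1 * r), (z1 * r).
      split; [by rewrite mulrA px1 | exact: HM |].
      by rewrite !mulrDl !mulrA.
  - move=> _ [x1 [y1 [z1 [px1 H1 [/esym xy0 ->]]]]].
    have [x0 y0] := sum0 _ _ px1 (qH _ _ H1) xy0.
    by rewrite x0 mulr0 add0r; apply: (pc_fun pcH); rewrite -y0.
  - move=> _ _ [x1 [y1 [z1 [px1 H1 [_ ->]]]]].
    exists (e * x1), z1, z1; split; first exact: Gpe.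
      exact: pc_idem pcH _ _ H1.
    by rewrite Gee.
  - move=> _ _ [x1 [y1 [z1 [px1 H1 [-> _]]]]].
    have [z Hz] := pc_stable pcH H1.
    exists (e * (a * x1 + p * (a * y1)) + z).
    exists (a * x1 + p * (a * y1)), (q * a * y1), z; split=> //.
      by rewrite mulrDr pax // [p * (p * _)]mulrA pp.
    by rewrite mulrDr -addrA adec.
  - move=> _ [x1 [y1 [z1 [px1 H1 [-> aE]]]]].
    (* Applying q isolates the lower diagonal block. *)
    have y10 : y1 = 0.
      apply: (pc_inj pcH); suff -> : q * a * y1 = z1 by [].
      have := congr1 ( *%R q) aE.
      rewrite mulrDr mulrDr (ppx (a * x1)); last exact: pax.
      by rewrite mulrDr (ppx (e * x1)) ?(qH' _ _ H1) ?Gpe // !add0r mulrA.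
    rewrite y10 in H1 aE *; move: aE; rewrite (pc_fun pcH H1) !addr0 => aE.
    by apply: (pc_inj pcG); rewrite -GE /= aE.
  - move=> _ _ [x1 [y1 [z1 [px1 H1 [-> _]]]]].
    (* Back substitution: solve in qS first, then in pS after subtracting the corner term p a y2. *)
    have [y2 [z2 [H2 y1E]]] := pc_surj pcH H1.
    have Gx : G (x1 - p * (a * y2), e * (x1 - p * (a * y2))).
      by rewrite -GE; split=> //=; rewrite mulrBr px1 mulrA pp.
    have [x2 [x2' [G2 x1E]]] := pc_surj pcG Gx.
    move: G2; rewrite -GE => -[/= px2 x2'E].
    exists (x2 + y2), (e * x2 + z2); split; first by exists x2, y2, z2.
    rewrite mulrDr opprD addrACA -x2'E x1E.
    have -> : a * y2 - z2 = p * (a * y2) + y1 by rewrite -y1E addrA adec.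
    by rewrite addrA subrK.
have GK : G `<=` K.
  rewrite -GE => -[x1 z] [/= px1 ->]; exists x1, 0, 0; split=> //.
  by rewrite !addr0.
have KG := maxG _ pcK GK.
have : K (h, h') by exists 0, h, h'; rewrite !mulr0 !add0r; split.
by rewrite KG -GE => -[/= ph _]; apply: h0; rewrite -(qH _ _ Hh) ppx.
Qed.

End RegularSelfInjective.

(** * From End(E)/J to End(E), and on to End(M) *)

Lemma clean_lift_mod_jacobson (S : pzRingType) :
  idempotents_lift_mod_jacobson S -> clean_ring (jac_quot S) -> clean_ring S.
Proof.
move=> liftS cleanS a.
pose pi := \pi_(jac_quot S)%qT.
have piM x y : pi (x * y) = pi x * pi y := jac_pi_mul x y.
have piD x y : pi (x + y) = pi x + pi y := jac_pi_add x y.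
have [e1 [v1 [ee uv aE]]] := cleanS (pi a).
elim/quotW: e1 ee aE => b bb aE.
(* Once the idempotent is lifted to e, a - e is a unit modulo J, hence a unit. *)
have [e [ee eb]] : exists e, idempotent_elt e /\ jacobson (e - b).
  by apply: liftS; apply/jac_piE; rewrite -/(pi _) piM.
have eE : pi e = pi b by apply/jac_piE.
exists e, (a - e); split=> //; last by rewrite addrC subrK.
apply: jac_invertible; suff -> : \pi_(jac_quot S)%qT (a - e) = v1 by [].
by apply: (addrI (pi e)); rewrite -piD addrC subrK eE.
Qed.

Section Envelopes.
Variables (R : pzRingType) (X : rmodType R -> Prop).

(** The composites of the two factorizations fix u and u', so both are automorphisms; h then has a
    left and a right inverse. *)
Lemma envelope_iso (M E E' : rmodType R) (u : {linear M -> E})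
    (u' : {linear M -> E'}) :
  envelope X u -> envelope X u' ->
  exists (h : {linear E -> E'}) (k : {linear E' -> E}),
    [/\ cancel h k, cancel k h & h \o u =1 u'].
Proof.
move=> [[XE preu] envu] [[XE' preu'] envu'].
have [h hu] := preu _ u' XE'; have [k ku'] := preu' _ u XE.
have [l kl _] : bijective (k \o h).
  by apply: envu => x /=; have /= -> := hu x; have /= -> := ku' x.
have [m _ mh] : bijective (h \o k).
  by apply: envu' => x /=; have /= -> := ku' x; have /= -> := hu x.
have hK : cancel h (l \o k) by move=> x; apply: kl.
have Kh : cancel (l \o k) h.
  by move=> x; rewrite -[x]mh /= [l _]hK.
pose k' : {linear E' -> E} :=
  HB.pack (l \o k) (GRing.isLinear.Build _ _ _ _ _ (can2_linear hK Kh)).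
by exists h, k'.
Qed.

(** Invariance speaks of some envelope; conjugating g by the isomorphism of envelopes transfers it
    to any other. *)
Lemma automorphism_invariant_envelope (M E : rmodType R) (u : {linear M -> E}) :
  automorphism_invariant X M -> envelope X u ->
  forall g : {linear E -> E}, bijective g ->
    exists f : {linear M -> M}, u \o f =1 g \o u.
Proof.
move=> [E' [u' [envu' invu']]] envu g bijg.
have [h [k [hK kK hu]]] := envelope_iso envu envu'.
have bijh : bijective h by exists k.
have bijk : bijective k by exists h.
have [f fE] := invu' (h \o (g \o k)) (bij_comp bijh (bij_comp bijg bijk)).
exists f => x; apply: (can_inj hK).
by have /= := fE x; have /= <- := hu x; have /= <- := hu (f x); rewrite hK.
Qed.

End Envelopes.

Theorem theorem3p14 (R : pzRingType) (X : rmodType R -> Prop)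
    (X_nonempty : exists N : rmodType R, X N)
    (X_iso : closed_under_iso X)
    (M E : rmodType R) (u : {linear M -> E})
    (u_envelope : envelope X u) (u_mono : injective u)
    (regEJ : von_neumann_regular (jac_quot (endo E)))
    (injEJ : right_self_injective (jac_quot (endo E)))
    (liftE : idempotents_lift_mod_jacobson (endo E))
    (M_inv : automorphism_invariant X M)
    (summands : forall N : submodClosed M,
      direct_summand N -> has_envelope X (submod_type N)) :
  clean_module M.
Proof.
move=> f; have [[XE preu] _] := u_envelope.
have [g gu] := preu _ (u \o f) XE.
have [e [v [ee [w [vw wv]] gE]]] := clean_lift_mod_jacobson liftE
  (regular_self_injective_clean regEJ injEJ) g.
have wK x : v (w x) = x := congr1 (fun t : endo E => t x) vw.
have vK x : w (v x) = x := congr1 (fun t : endo E => t x) wv.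
have [|v' v'E] := automorphism_invariant_envelope M_inv u_envelope (g := v).
  by exists w.
have [|w' w'E] := automorphism_invariant_envelope M_inv u_envelope (g := w).
  by exists v.
have v'u x : u (v' x) = v (u x) := v'E x.
have w'u x : u (w' x) = w (u x) := w'E x.
(* Thus f - v' is the restriction of e to M, and inherits idempotence through u. *)
have eu x : u (f x - v' x) = e (u x).
  have -> : u (f x - v' x) = u (f x) - u (v' x) := raddfB u _ _.
  rewrite v'u; have /= <- := gu x.
  have -> : g (u x) = e (u x) + v (u x) := congr1 (fun t : endo E => t (u x)) gE.
  by rewrite addrK.
exists ((f : endo M) - (v' : endo M)), (v' : endo M); split.
- apply: lin_ext => x; apply: u_mono.
  rewrite [LHS]eu [X in e X]eu [RHS]eu.
  exact: (congr1 (fun t : endo E => t (u x)) ee).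
- exists w'; split; apply: lin_ext => x; apply: u_mono.
  + by rewrite [LHS]v'u [u _]w'u wK.
  + by rewrite [LHS]w'u [u _]v'u vK.
- by rewrite subrK.
Qed.
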